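(* For a homogeneous effect algebra $E$, the set $E_S$ of all sharp elements of $E$ is a sub-effect algebra of $E$. Moreover, $E_S$ is an orthoalgebra.
   Context: An effect algebra is a partial algebra $(E;\oplus,0,1)$ with a partial binary operation $\oplus$ and two constants $0,1$ such that: (E1) if $a\oplus b$ is defined, then $b\oplus a$ is defined and $a\oplus b=b\oplus a$; (E2) if $a\oplus b$ and $(a\oplus b)\oplus c$ are defined, then $b\oplus c$ and $a\oplus(b\oplus c)$ are defined and $(a\oplus b)\oplus c=a\oplus(b\oplus c)$; (E3) for every $a\in E$ there is a unique $a'\in E$ with $a\oplus a'=1$; (E4) if $a\oplus 1$ is defined, then $a=0$. Write $a\le b$ iff there is $c\in E$ with $a\oplus c=b$; this is a partial order with least element $0$ and greatest element $1$, and if $a\le b$ then $b\ominus a$ denotes the unique $c$ with $a\oplus c=b$. Write $a\perp b$ iff $a\oplus b$ is defined. A sub-effect algebra of $E$ is a subset $E_0\subseteq E$ with $1\in E_0$ and $a\ominus b\in E_0$ for all $a,b\in E_0$ with $a\ge b$; it is then an effect algebra with the restricted operation. An effect algebra is an orthoalgebra iff $a\perp a$ implies $a=0$. An element $a\in E$ is sharp iff $a\wedge a'=0$ (i.e. $0$ is the only element below both $a$ and $a'$); $E_S$ is the set of all sharp elements of $E$. An effect algebra $E$ is homogeneous iff for all $u,v_1,v_2\in E$ such that $v_1\perp v_2$, $u\le v_1\oplus v_2$ and $u\le (v_1\oplus v_2)'$, there are $u_1,u_2\in E$ with $u_1\le v_1$, $u_2\le v_2$ and $u=u_1\oplus u_2$.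 *)

(* Defs.v *)
From mathcomp Require Import all_boot.
From mathcomp Require Import boolp classical_sets.

Set Implicit Arguments.
Unset Strict Implicit.
Unset Printing Implicit Defensive.

Local Open Scope classical_set_scope.

(* [oplus a b = Some c] means that the sum of a and b is defined and equals c.
   As usual for effect algebras, 0 <> 1 is not required. *)
Record effectAlgebra := EffectAlgebra {
  ea_sort :> Type;
  oplus : ea_sort -> ea_sort -> option ea_sort;
  ea0 : ea_sort;
  ea1 : ea_sort;
  oplusC : forall a b c, oplus a b = Some c -> oplus b a = Some c;
  oplusA : forall a b c ab abc, oplus a b = Some ab -> oplus ab c = Some abc ->
    exists2 bc, oplus b c = Some bc & oplus a bc = Some abc;
  ea_compl_ex : forall a, exists! a', oplus a a' = Some ea1;
  ea_perp1 : forall a, oplus a ea1 -> a = ea0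
}.

Arguments ea0 {_}.
Arguments ea1 {_}.

Section Notions.
Variable E : effectAlgebra.
Implicit Types a b c : E.

Definition perp a b : Prop := oplus a b.

Definition ea_le a b : Prop := exists c, oplus a c = Some b.

Definition ominus b a (hab : ea_le a b) : E := sval (cid hab).

Definition compl a : E := sval (cid (ea_compl_ex a)).

Definition is_meet a b m : Prop :=
  [/\ ea_le m a, ea_le m b
    & forall x, ea_le x a -> ea_le x b -> ea_le x m].

Definition sharp a : Prop := is_meet a (compl a) ea0.

Definition sharp_set : set E := [set a | sharp a].

Definition is_sub_effect_algebra (S : set E) : Prop :=
  S ea1 /\ forall a b (hba : ea_le b a), S a -> S b -> S (ominus hba).

Definition orthoalgebra : Prop := forall a, perp a a -> a = ea0.

Definition homogeneous : Prop :=
  forall u v1 v2 v, oplus v1 v2 = Some v -> ea_le u v -> ea_le u (compl v) ->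
    exists u1 u2, [/\ ea_le u1 v1, ea_le u2 v2 & oplus u1 u2 = Some u].

Lemma oplus_compl a : oplus a (compl a) = Some ea1.
Proof. by rewrite /compl; case: cid => x []. Qed.

Lemma compl_uniq a b : oplus a b = Some ea1 -> b = compl a.
Proof.
move=> ab; rewrite /compl; case: cid => x /= [_ xP].
by rewrite (xP _ ab).
Qed.

Lemma oplus_cancel a b b' c :
  oplus a b = Some c -> oplus a b' = Some c -> b = b'.
Proof.
have H d : oplus a d = Some c ->
    exists2 x, oplus a (compl c) = Some x & oplus x d = Some ea1.
  move=> /oplusC da; have [x ax xd] := oplusA da (oplus_compl c).
  by exists x => //; exact: oplusC.
move=> /H[x ax xb] /H[y]; rewrite ax => -[<-] xb'.
by rewrite (compl_uniq xb) (compl_uniq xb').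
Qed.

Lemma ominusE a b c (hab : ea_le a b) : oplus a c = Some b -> ominus hab = c.
Proof.
by move=> abc; rewrite /ominus; case: cid => x abx; exact: oplus_cancel abx abc.
Qed.

Lemma oplus10 : oplus ea1 ea0 = Some (ea1 : E).
Proof.
have h := oplus_compl (ea1 : E).
suff <- : compl ea1 = ea0 by [].
by apply: ea_perp1; rewrite (oplusC h).
Qed.

Lemma oplusr0 a : oplus a ea0 = Some a.
Proof.
have [x ex e1] := oplusA (oplusC (oplus_compl a)) oplus10.
by rewrite ex (oplus_cancel e1 (oplusC (oplus_compl a))).
Qed.

Lemma ea_le0x a : ea_le ea0 a.
Proof. by exists a; apply/oplusC/oplusr0. Qed.

Lemma ea_lex0 a : ea_le a ea0 -> a = ea0.
Proof.
move=> [c ac]; have [x cx _] := oplusA ac (oplusC oplus10).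
have c0 : c = ea0 by apply: ea_perp1; rewrite cx.
by move: ac; rewrite c0 oplusr0 => -[].
Qed.

Lemma sharpP a :
  sharp a <-> forall x, ea_le x a -> ea_le x (compl a) -> x = ea0.
Proof.
split=> [[_ _ h] x xa xa'|h]; first exact/ea_lex0/h.
split; [exact: ea_le0x | exact: ea_le0x |].
by move=> x xa xa'; rewrite (h x xa xa'); exact: ea_le0x.
Qed.

Section Sub.
Variable S : set E.
Hypothesis hS : is_sub_effect_algebra S.

Lemma sub_diff a b c : oplus a c = Some b -> S a -> S b -> S c.
Proof.
move=> acb Sa Sb; have h : ea_le a b by exists c.
by rewrite -(ominusE h acb); exact: hS.2.
Qed.

Lemma sub_ea0 : S ea0.
Proof. exact: sub_diff oplus10 hS.1 hS.1. Qed.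

(* The restriction to S: the sum is defined when it is defined in E and lies
   in S (the latter being automatic, by [sub_oplus_closed]). *)
Definition sub_oplus (a b : set_type S) : option (set_type S) :=
  obind insub (oplus (val a) (val b)).

Lemma sub_oplusE (a b c : set_type S) :
  sub_oplus a b = Some c <-> oplus (val a) (val b) = Some (val c).
Proof.
rewrite /sub_oplus; split=> [|->] /=; last by rewrite valK.
by case: oplus => //= x; case: insubP => // u _ <- [->].
Qed.

Lemma sub_oplus_closed a b c : oplus a b = Some c -> S a -> S b -> S c.
Proof.
have Scompl d : S d -> S (compl d).
  by move=> Sd; apply: (sub_diff (oplus_compl d) Sd hS.1).
move=> abc Sa Sb.
have [x bx ax] := oplusA abc (oplus_compl c).
have Sx : S x by rewrite (compl_uniq ax); exact: Scompl.
apply: (sub_diff (oplusC (oplus_compl c)) _ hS.1).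
exact: sub_diff bx Sb Sx.
Qed.

Definition sub_ea_elt x (Sx : S x) : set_type S := exist _ x (mem_set Sx).

Lemma sub_oplusC (a b c : set_type S) :
  sub_oplus a b = Some c -> sub_oplus b a = Some c.
Proof. by move=> /sub_oplusE/oplusC/sub_oplusE. Qed.

Lemma sub_oplusA (a b c ab abc : set_type S) :
  sub_oplus a b = Some ab -> sub_oplus ab c = Some abc ->
  exists2 bc, sub_oplus b c = Some bc & sub_oplus a bc = Some abc.
Proof.
move=> /sub_oplusE h1 /sub_oplusE h2; have [x bx ax] := oplusA h1 h2.
have Sx : S x by apply: sub_oplus_closed bx _ _; exact/set_mem/valP.
by exists (sub_ea_elt Sx); apply/sub_oplusE.
Qed.

Lemma sub_compl_ex (a : set_type S) :
  exists! a' : set_type S, sub_oplus a a' = Some (sub_ea_elt hS.1).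
Proof.
have Sa : S (compl (val a)).
  by apply: (sub_diff (oplus_compl _) _ hS.1); exact/set_mem/valP.
exists (sub_ea_elt Sa); split; first exact/sub_oplusE/oplus_compl.
by move=> x /sub_oplusE/compl_uniq h; apply: val_inj.
Qed.

Lemma sub_perp1 (a : set_type S) :
  sub_oplus a (sub_ea_elt hS.1) -> a = sub_ea_elt sub_ea0.
Proof.
move=> h; apply: val_inj; apply: ea_perp1.
by move: h; rewrite /sub_oplus /=; case: oplus.
Qed.

Definition sub_effectAlgebra : effectAlgebra :=
  EffectAlgebra sub_oplusC sub_oplusA sub_compl_ex sub_perp1.

End Sub.
End Notions.

Arguments sharp_set E : clear implicits.
Arguments homogeneous E : clear implicits.
Arguments orthoalgebra E : clear implicits.

(* Main.v *)
Require Import Defs.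
From mathcomp Require Import all_boot.
From mathcomp Require Import boolp classical_sets.

Set Implicit Arguments.
Unset Strict Implicit.
Unset Printing Implicit Defensive.

(** Since [(a (-) b)' = b (+) a'] and sharpness is invariant under complement,
    closure under differences reduces to closure under orthogonal sums
    ([sharp_oplus]).  That is where homogeneity enters: an element [u] below
    both [a (+) b] and its complement splits as [u1 (+) u2] with [u1 <= a] and
    [u2 <= b].  Complementation is antitone, so [u1] is also below [a'] and [u2]
    below [b'], and sharpness of [a] and [b] annihilates both pieces.  A sharp
    element orthogonal to itself lies below its own complement, so it is 0;
    hence the sharp elements form an orthoalgebra. *)

Section EffectAlgebraOrder.
Variable E : effectAlgebra.
Implicit Types a b c x : E.

Lemma oplus_lel a b c : oplus a b = Some c -> ea_le a c.
Proof. by exists b. Qed.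

Lemma oplus_ler a b c : oplus a b = Some c -> ea_le b c.
Proof. by exists a; apply: oplusC. Qed.

Lemma ea_le_trans b a c : ea_le a b -> ea_le b c -> ea_le a c.
Proof. by move=> [x ax] [y bybc]; have [z _ az] := oplusA ax bybc; exists z. Qed.

Lemma complK a : compl (compl a) = a.
Proof. by rewrite -(compl_uniq (oplusC (oplus_compl a))). Qed.

(** Associating [(a (+) b) (+) c' = 1] to the right exhibits [b (+) c'] as the
    complement of [a].  Both the antitonicity of complementation and the formula
    [(c (-) b)' = b (+) c'] are read off from this. *)
Lemma oplus_compl_shift a b c :
  oplus a b = Some c -> oplus b (compl c) = Some (compl a).
Proof.
move=> abc; have [x bx ax] := oplusA abc (oplus_compl c).
by rewrite bx (compl_uniq ax).
Qed.

Lemma ea_le_compl a c : ea_le a c -> ea_le (compl c) (compl a).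
Proof. by move=> [b /oplus_compl_shift/oplus_ler]. Qed.

Lemma perp_le_compl a b : perp a b -> ea_le a (compl b).
Proof.
rewrite /perp; case abc: (oplus a b) => [c|] // _.
exact: oplus_lel (oplus_compl_shift (oplusC abc)).
Qed.

End EffectAlgebraOrder.

Section Sharp.
Variable E : effectAlgebra.
Implicit Types a b c : E.

Lemma sharp_compl a : sharp a -> sharp (compl a).
Proof. by move=> /sharpP sa; apply/sharpP => x; rewrite complK => ? /sa; apply. Qed.

Lemma sharp1 : sharp (ea1 : E).
Proof. by apply/sharpP => x _; rewrite -(compl_uniq (oplus10 E)); apply: ea_lex0. Qed.

Lemma sharp_perp_self a : sharp a -> perp a a -> a = ea0.
Proof.
by move=> /sharpP sa /perp_le_compl; apply: sa; exists ea0; apply: oplusr0.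
Qed.

(** The hypothesis of homogeneity on [u] is exactly what membership in the
    lower bounds of [c] and [c'] gives, so [u] splits along [c = a (+) b], and
    each piece is a common lower bound of a sharp summand and its complement. *)
Lemma sharp_oplus (hE : homogeneous E) a b c :
  oplus a b = Some c -> sharp a -> sharp b -> sharp c.
Proof.
move=> abc /sharpP sa /sharpP sb; apply/sharpP => u uc uc'.
have [u1 [u2 [u1a u2b u12]]] := hE _ _ _ _ abc uc uc'.
have u10 : u1 = ea0.
  apply: sa u1a (ea_le_trans (ea_le_trans (oplus_lel u12) uc') _).
  exact: ea_le_compl (oplus_lel abc).
have u20 : u2 = ea0.
  apply: sb u2b (ea_le_trans (ea_le_trans (oplus_ler u12) uc') _).
  exact: ea_le_compl (oplus_ler abc).
by move: u12; rewrite u10 u20 oplusr0 => -[].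
Qed.

Lemma sharp_sub_effect_algebra (hE : homogeneous E) :
  is_sub_effect_algebra (sharp_set E).
Proof.
split=> [|a b hba sa sb]; first exact: sharp1.
have [c bca] := hba; rewrite (ominusE hba bca).
rewrite /sharp_set /= -(complK c); apply: sharp_compl.
apply: (sharp_oplus hE (oplus_compl_shift (oplusC bca))) => //.
exact: sharp_compl.
Qed.

End Sharp.

Theorem corollary4p4 (E : effectAlgebra) (hE : homogeneous E) :
  exists hS : is_sub_effect_algebra (sharp_set E),
    orthoalgebra (sub_effectAlgebra hS).
Proof.
exists (sharp_sub_effect_algebra hE) => a; rewrite /perp.
case aac: (oplus a a) => [c|] // _; apply: val_inj => /=.
move/sub_oplusE: aac => aac.
apply: sharp_perp_self; first exact: (set_mem (valP a)).
by rewrite /perp aac.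
Qed.
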